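(* Let $\phi$ be an essentially smooth transformation whose conjugate $\psi=\phi^\star$ is thrice continuously differentiable with $\psi''>0$. Write $R_{\psi'}(t)=\psi'''(t)/\psi''(t)$, and let $\rho_\gamma$ be the response function generated by $\phi$ for $\gamma\in(0,1)$. The following statements are equivalent: (i) For all $\gamma\in(0,1)$, $\rho_\gamma$ is concave (on $(0,+\infty)$). (ii) $R_{\psi'}(t)\ge0$ for $t<0$, and $R_{\psi'}(t)\le0$ for $t>0$. (iii) $\phi'''(t)\le0$ for $t\in(0,1)$, and $\phi'''(t)\ge0$ for $t>1$.
   Context: A transformation is a convex, lower semicontinuous $\phi:\mathbb{R}_+\to[0,+\infty]$ with $\phi(1)=0$ which (standing assumption) is superlinear at infinity ($\phi(t)/t\to+\infty$ as $t\to+\infty$), strictly convex on $\operatorname{int}(\operatorname{dom}\phi)$, and satisfies $1\in\operatorname{int}(\operatorname{dom}\phi)$. It is essentially smooth if it is finite and differentiable on $(0,+\infty)$ and $\lim_{t\to0}\phi'(t)=-\infty$. Conjugate: $\psi(t)=\phi^\star(t)=\sup_{u\ge0}tu-\phi(u)$, $t\in\mathbb{R}$. (The assumption on $\psi$ is equivalent to $\phi$ being thrice continuously differentiable with $\phi''>0$ on $(0,+\infty)$.) For $\gamma\in(0,1)$, the response function is $\rho_\gamma:(0,+\infty)\to(0,1)$, $\rho_\gamma(w)=\gamma\psi'(w-\ell_\gamma(w))$, where $\ell_\gamma(w)\in\mathbb{R}$ is the unique solution of $\gamma\psi'(w-\ell_\gamma(w))+(1-\gamma)\psi'(-\ell_\gamma(w))=1$.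 *)

(* Defs.v *)
(* MathComp-Analysis, over an abstract [R : realType]. *)
From HB Require Import structures.
From mathcomp Require Import all_boot all_order all_algebra.
From mathcomp Require Import all_classical all_reals all_analysis.

Set Implicit Arguments.
Unset Strict Implicit.
Unset Printing Implicit Defensive.

Import Order.TTheory GRing.Theory Num.Theory.
Import numFieldTopology.Exports numFieldNormedType.Exports.

Local Open Scope classical_set_scope.
Local Open Scope ring_scope.

(* A function on R_+ with values in [0, +oo] is encoded as [phi : R -> \bar R];
   no definition below depends on the values of [phi] at negative reals. *)
Section Transformation.
Context {R : realType}.
Implicit Types phi : R -> \bar R.

Definition Rplus : set R := `[0, +oo[.

Definition dom phi : set R := [set t | Rplus t /\ (phi t < +oo)%E].

Definition ext_convex_on (D : set R) phi : Prop :=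
  forall x y p : R, D x -> D y -> 0 <= p <= 1 ->
    (phi (p * x + (1 - p) * y)%R <= p%:E * phi x + (1 - p)%:E * phi y)%E.

Definition ext_strictly_convex_on (D : set R) phi : Prop :=
  forall x y p : R, D x -> D y -> x != y -> 0 < p < 1 ->
    (phi (p * x + (1 - p) * y)%R < p%:E * phi x + (1 - p)%:E * phi y)%E.

(* Lower semicontinuity is for the topology induced on R_+: in [subspace Rplus]
   the points outside [Rplus] are isolated, so they impose no condition. *)
Record transformation phi : Prop := Transformation {
  transf_ge0 : forall t, Rplus t -> (0 <= phi t)%E;
  transf_convex : ext_convex_on Rplus phi;
  transf_lsc : lower_semicontinuous (phi : subspace Rplus -> \bar R);
  transf_at1 : phi 1 = 0%E;
  transf_superlinear : (phi t * t^-1%:E)%E @[t --> +oo%R] --> +oo%E;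
  transf_strictly_convex : ext_strictly_convex_on (interior (dom phi)) phi;
  transf_1_interior : interior (dom phi) 1 }.

Record essentially_smooth phi : Prop := EssentiallySmooth {
  esmooth_finite : forall t, 0 < t -> phi t \is a fin_num;
  esmooth_derivable : forall t, 0 < t -> derivable (fine \o phi) t 1;
  esmooth_at0 : (fine \o phi)^`()%classic t @[t --> 0^'+] --> -oo%R }.

Definition conjugate phi (t : R) : \bar R :=
  ereal_sup [set ((t * u)%:E - phi u)%E | u in Rplus].

(* For a transformation, [conjugate phi] is finite everywhere by
   superlinearity, so [fine] loses nothing. *)
Definition conj_fun phi : R -> R := fine \o conjugate phi.

Definition thrice_continuously_differentiable (f : R -> R) : Prop :=
  (forall k : nat, (k < 3)%N -> forall t, derivable (f^`(k)%classic) t 1) /\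
  continuous (f^`(3)%classic).

Definition R_ratio (f : R -> R) (t : R) : R := f^`(2)%classic t / f^`()%classic t.

(* [psi] stands for [conj_fun phi]. If [psi^`()] is a strictly increasing
   continuous bijection from R onto ]0, +oo[ and [0 < gamma < 1], the equation
   below has exactly one solution [l], which [get] returns. *)
Definition ell (psi : R -> R) (gamma w : R) : R :=
  get [set l | gamma * psi^`()%classic (w - l) + (1 - gamma) * psi^`()%classic (- l) = 1].

Definition response (psi : R -> R) (gamma w : R) : R :=
  gamma * psi^`()%classic (w - ell psi gamma w).

Definition concave_function (D : set R) (f : R -> R) : Prop :=
  convex_function D (\- f : R -> R^o).

End Transformation.

(* Main.v *)
Require Import Defs.
From HB Require Import structures.
From mathcomp Require Import all_boot all_order all_algebra.
From mathcomp Require Import ring lra.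
From mathcomp Require Import all_classical all_reals all_analysis.

Set Implicit Arguments.
Unset Strict Implicit.
Unset Printing Implicit Defensive.

Import Order.TTheory GRing.Theory Num.Theory.
Import numFieldTopology.Exports numFieldNormedType.Exports.

Local Open Scope classical_set_scope.
Local Open Scope ring_scope.

(* Tangent lines of phi show that k = phi' inverts g = psi', so k' = 1 / g'(k)
   and k'' = phi''' = - g''(k) / g'(k)^3, whence (ii) <-> (iii).  The response
   rho_gamma has the explicit inverse
     W p = k (p / gamma) - k ((1 - p) / (1 - gamma)),   gamma < p < 1,
   which is increasing, so rho_gamma is concave iff W is convex iff
     k''(b) / (1 - gamma)^2 <= k''(a) / gamma^2
   with b = (1 - p) / (1 - gamma) < 1 < a = p / gamma.  Under (iii) the two sides
   have opposite signs.  Conversely any b < 1 < a arises from some gamma and p,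
   the inequality becomes (1 - b)^2 k''(b) <= (a - 1)^2 k''(a), and letting
   b tend to 1 (resp. a tend to 1) makes one side vanish. *)

(** * Convexity on an interval through first and second derivatives *)

Lemma convex_tangent_le (R : realType) (f : R -> R) (x y : R) :
  derivable f x 1 ->
  (forall t, 0 < t < 1 -> f (t * y + (1 - t) * x) <= t * f y + (1 - t) * f x) ->
  f^`()%classic x * (y - x) <= f y - f x.
Proof.
move=> /derivable1_diffP df cf.
have -> : f^`()%classic x * (y - x) = 'D_(y - x) f x.
  rewrite derive1E' // deriveE // -[in RHS](mulr1 (y - x)).
  by rewrite -[(y - x) * 1]/((y - x) *: (1 : R^o)) linearZ mulrC.
have dv : derivable f x (y - x) by exact: diff_derivable.
(* Only h > 0 is kept: for h in ]0, 1[ the quotient evaluates [f] at a convex combination of [x] and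
   [y], so the hypothesis bounds it, and hence its limit, by [f y - f x]. *)
have dvr : (h^-1 *: (f (h *: (y - x) + x) - f x)) @[h --> 0^'+] --> 'D_(y - x) f x.
  apply: cvg_trans dv; apply: cvg_app => A [e e0 Ae].
  by exists e => // z ze z0; apply: Ae => //; exact: lt0r_neq0.
rewrite -(cvg_lim _ dvr) //; apply: limr_le.
  by apply/cvg_ex; exists ('D_(y - x) f x).
near=> h.
have h0 : 0 < h by near: h; exact: nbhs_right_gt.
have h1 : h < 1 by near: h; exact: nbhs_right_lt.
rewrite [_ *: _]mulrC ler_pdivrMr //.
have := cf h; rewrite h0 h1 => /(_ isT).
have -> : h * y + (1 - h) * x = h *: (y - x) + x by rewrite /GRing.scale /=; ring.
by move=> H; lra.
Unshelve. all: by end_near. Qed.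

(** Divided by (y - x)^2, the product is the difference quotient. Adding the tangent inequalities at
    [x] and at [y] yields monotonicity of a derivative in exactly this product form. *)
Lemma nondecreasing_derive1_ge0 (R : realType) (f : R -> R) (x : R) :
  derivable f x 1 -> (\forall y \near x, 0 <= (f y - f x) * (y - x)) ->
  0 <= f^`()%classic x.
Proof.
move=> df.
rewrite (near_shift 0 x) derive1E => fx; apply: limr_ge => //.
apply: cvg_within; apply: filterS fx => h /=.
rewrite subr0 addrK /GRing.scale /= mulr1 => fh.
(* The punctured neighbourhood was enlarged to a full one; at h = 0 the convention 0^-1 = 0 makes
   the quotient vanish. *)
have [->|h0] := eqVneq h 0; first by rewrite invr0 mul0r.
have -> : h^-1 * (f (h + x) - f x) = (f (h + x) - f x) * h / (h * h) by field.
by rewrite divr_ge0 // -expr2 sqr_ge0.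
Qed.

(** Applying the increasing [W] to the concavity inequality of [r] at [W p], [W q] gives the
    convexity inequality of [W] at [p], [q], and conversely. Convexity of [D] and [E] keeps the
    averages where monotonicity and cancellation are available. *)
Lemma concave_inverse (R : realType) (W r : R -> R) (D E : set R) :
  convex_set (D : set (convex_lmodType R^o)) ->
  convex_set (E : set (convex_lmodType R^o)) ->
  {in D &, {mono W : x y / x <= y}} ->
  (forall p, D p -> E (W p)) -> (forall w, E w -> D (r w)) ->
  {in D, cancel W r} -> {in E, cancel r W} ->
  concave_function E r <-> convex_function D (W : R -> R^o).
Proof.
move=> Dconv Econv Wmono WE rD Wr rW.
have rDin w : w \in E -> r w \in D by move=> /set_mem /rD /mem_set.
have WEin w : w \in D -> W w \in E by move=> /set_mem /WE /mem_set.
split=> [cr t p q Dp Dq|cW t v w Ev Ew].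
  have := cr t (W p) (W q) (WEin _ Dp) (WEin _ Dq).
  rewrite /= !convRE !Wr // !mulrN -opprD lerN2 => h.
  have Ez := Econv _ _ t (WEin _ Dp) (WEin _ Dq).
  rewrite -[leRHS](rW _ Ez) Wmono //; [exact: Dconv | exact: rDin].
have Dz := Dconv _ _ t (rDin _ Ev) (rDin _ Ew).
have Ez := Econv _ _ t Ev Ew.
rewrite /= !convRE !mulrN -opprD lerN2 -!convRE.
rewrite -Wmono // ?rDin // rW //.
by apply: le_trans (cW t _ _ (rDin _ Ev) (rDin _ Ew)) _; rewrite !rW.
Qed.

Lemma convex_second_derivativeP (R : realType) (f : R -> R) (a b : R) :
  {in `]a, b[, forall x, derivable f x 1} ->
  {in `]a, b[, forall x, derivable f^`()%classic x 1} ->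
  convex_function `]a, b[%classic (f : R -> R^o) <->
  {in `]a, b[, forall x, 0 <= f^`(2)%classic x}.
Proof.
move=> df ddf; split=> [cf|f2_ge0].
  have tang x y : x \in `]a, b[ -> y \in `]a, b[ ->
      f^`()%classic x * (y - x) <= f y - f x.
    move=> xab yab; apply: convex_tangent_le; first exact: df.
    move=> t /andP[t0 t1].
    by have := cf (Itv01 (ltW t0) (ltW t1)) y x; apply; exact: mem_set.
  move=> x xab; apply: nondecreasing_derive1_ge0; first exact: ddf.
  near=> y.
  have yab : y \in `]a, b[ by near: y; exact: near_in_itvoo.
  by have := tang x y xab yab; have := tang y x yab xab; lra.
have main t x y : x <= y -> x \in `]a, b[ -> y \in `]a, b[ ->
    f (conv t (x : R^o) (y : R^o)) <= conv t (f x : R^o) (f y : R^o).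
  move=> xy xab yab.
  have sub z : z \in `[x, y] -> z \in `]a, b[.
    move: xab yab; rewrite !in_itv /= => /andP[ax xb] /andP[ay yb] /andP[xz zy].
    by rewrite (lt_le_trans ax) // (le_lt_trans zy).
  have cont z : z \in `[x, y] -> {for z, continuous f}.
    by move=> /sub/df/derivable1_diffP/differentiable_continuous.
  have D1 : 'D_1 f = f^`()%classic by apply/funext => z; rewrite derive1E.
  apply: (@second_derivative_convex R f x y _ _ _ _ _ t xy).
  - move=> z /andP[xz zy]; rewrite D1 -derive1E; apply: f2_ge0.
    by apply: sub; rewrite in_itv /= !ltW.
  - by apply: cvg_at_left_filter; apply: cont; rewrite in_itv /= xy lexx.
  - by apply: cvg_at_right_filter; apply: cont; rewrite in_itv /= xy lexx.
  - by move=> z /subset_itv_oo_cc/sub/df.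
  - by move=> z /subset_itv_oo_cc/sub/ddf; rewrite D1.
move=> t x y /set_mem xab /set_mem yab.
have [xy|/ltW yx] := leP x y; first exact: main.
rewrite convC [leRHS]convC; exact: main.
Unshelve. all: by end_near. Qed.

Lemma increasing_of_derive1_gt0 (R : realType) (f : R -> R) :
  (forall t, derivable f t 1) -> (forall t, 0 < f^`()%classic t) ->
  {mono f : x y / x <= y}.
Proof.
move=> df f1_gt0; apply: le_mono => x y xy.
apply: (@gtr0_derive1_lt_cc R f x y) => //; rewrite ?in_itv /= ?lexx ?(ltW xy) //.
by apply: derivable_within_continuous => z _; exact: df.
Qed.

(** * Legendre duality: the derivatives of [phi] and of its conjugate are inverse to each other *)

Section LegendreDuality.
Variables (R : realType) (phi : R -> \bar R).
Hypothesis phi_transf : transformation phi.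
Hypothesis phi_esmooth : essentially_smooth phi.

Local Notation f := (fine \o phi).

Lemma phi_fineK u : 0 < u -> phi u = (f u)%:E.
Proof. by move=> u0; rewrite /= fineK //; exact: esmooth_finite. Qed.

Lemma conjugate_ge (t u : R) : 0 < u -> ((t * u - f u)%:E <= conjugate phi t)%E.
Proof.
move=> u0; apply: ereal_sup_ubound; exists u => /=.
  by rewrite /Rplus /= in_itv /= ltW.
by rewrite (phi_fineK u0) EFinB.
Qed.

(** The point u = 1 bounds the supremum from below. From above, superlinearity makes t u - phi u
    nonpositive beyond some [M], while phi >= 0 leaves at most |t| B on [0, B]. *)
Lemma conjugate_fin_num t : conjugate phi t \is a fin_num.
Proof.
rewrite fin_numElt; apply/andP; split.
  exact: lt_le_trans (ltNyr _) (conjugate_ge t ltr01).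
have /cvgeyPge/(_ t) := transf_superlinear phi_transf.
move=> [M [_ HM]].
pose B := Num.max M 0.
suff: (conjugate phi t <= (`|t| * B)%:E)%E by move=> /le_lt_trans; apply; rewrite ltry.
apply: ge_ereal_sup => _ [u /= + <-].
rewrite /Rplus /= in_itv /= andbT => u_ge0.
have phi_ge0 : (0 <= phi u)%E.
  by apply: (transf_ge0 phi_transf); rewrite /Rplus /= in_itv /= u_ge0.
have B0 : 0 <= B by rewrite le_max lexx orbT.
have [uB|Bu] := leP u B.
  apply: (@le_trans _ _ (t * u)%:E); last first.
    rewrite lee_fin; apply: le_trans (ler_norm _) _.
    by rewrite normrM ler_wpM2l // ger0_norm.
  case: (phi u) phi_ge0 => [r| |] //=; last by rewrite leNye.
  by rewrite -EFinB !lee_fin => r0; lra.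
have u0 : 0 < u by exact: le_lt_trans Bu.
have /HM : M < u by apply: le_lt_trans Bu; rewrite le_max lexx.
rewrite (phi_fineK u0) -EFinM -EFinB !lee_fin ler_pdivlMr // => H.
by apply: (@le_trans _ _ 0); rewrite ?subr_le0 // mulr_ge0.
Qed.

Lemma conj_fun_ge (t u : R) : 0 < u -> t * u - f u <= conj_fun phi t.
Proof.
move=> u0; rewrite -lee_fin /conj_fun /= fineK ?conjugate_fin_num //.
exact: conjugate_ge.
Qed.

(** The endpoint v = 0 is included because the conjugate is a supremum over all of R_+; where
    [phi v] is infinite the bound is trivial. *)
Lemma phi_tangent_le (u v : R) : 0 < u -> 0 <= v ->
  ((f u + f^`()%classic u * (v - u))%:E <= phi v)%E.
Proof.
move=> u0 v0.
have [phiv|] := boolP (phi v \is a fin_num); last first.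
  rewrite ge0_fin_numE ?(transf_ge0 phi_transf) /Rplus /= ?in_itv /= ?v0 //.
  by rewrite -leNgt leye_eq => /eqP ->; rewrite leey.
rewrite -(fineK phiv) lee_fin addrC -lerBrDr.
apply: (@convex_tangent_le R f); first exact: (esmooth_derivable phi_esmooth).
move=> t /andP[t0 t1].
have w0 : 0 < t * v + (1 - t) * u.
  by rewrite ltr_wpDl // ?mulr_ge0 ?mulr_gt0 ?subr_gt0 // ltW.
have := @transf_convex _ _ phi_transf v u t.
rewrite /Rplus /= !in_itv /= !andbT v0 (ltW u0) (ltW t0) (ltW t1) => /(_ isT isT isT).
by rewrite (phi_fineK u0) (phi_fineK w0) -(fineK phiv) -!EFinM -EFinD lee_fin.
Qed.

(** Equality case of the Fenchel-Young inequality: as [phi] lies above its tangent line at [u], the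
    supremum is attained at v = u. *)
Lemma conj_fun_derive1_phi (u : R) : 0 < u ->
  conj_fun phi (f^`()%classic u) = f^`()%classic u * u - f u.
Proof.
move=> u0; apply/eqP; rewrite eq_le conj_fun_ge // andbT.
rewrite -lee_fin /conj_fun /= fineK ?conjugate_fin_num //.
apply: ge_ereal_sup => _ [v /= + <-].
rewrite /Rplus /= in_itv /= andbT => v0.
have := phi_tangent_le u0 v0.
case: (phi v) => [x| |] //=; last by rewrite leNye.
by rewrite -EFinB !lee_fin => H; lra.
Qed.

Hypothesis psi_derivable : forall t, derivable (conj_fun phi) t 1.

(* The tangent line of phi at u makes s |-> psi s - u s minimal at phi' u. *)
Lemma derive1_conj_funK (u : R) : 0 < u ->
  (conj_fun phi)^`()%classic (f^`()%classic u) = u.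
Proof.
move=> u0; set t := f^`()%classic u.
pose h : R -> R := conj_fun phi - u \*: (id : R -> R).
have dh (s : R) : is_derive s 1 h ((conj_fun phi)^`()%classic s - u *: (1 : R)).
  have ds : is_derive s 1 (conj_fun phi) ((conj_fun phi)^`()%classic s).
    by rewrite derive1E; exact: derivableP.
  exact: is_deriveB.
have [_] : is_derive t 1 h 0.
  apply: (@derive1_at_min R h (t - 1) (t + 1)) => //; first by lra.
    by rewrite in_itv /=; apply/andP; split; lra.
  move=> s _; rewrite /h /= !fctE /= conj_fun_derive1_phi //.
  by have := conj_fun_ge s u0; rewrite -/t /GRing.scale /=; lra.
have [_ ->] := dh t; rewrite /GRing.scale /= mulr1 => /eqP.
by rewrite subr_eq0 => /eqP.
Qed.

Hypothesis psi1_mono : {mono (conj_fun phi)^`()%classic : x y / x <= y}.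

(** Since phi' tends to -oo at 0, some u > 0 has phi' u < t, and monotonicity gives psi' t > psi'
    (phi' u) = u > 0. *)
Lemma derive1_conj_fun_gt0 t : 0 < (conj_fun phi)^`()%classic t.
Proof.
have /cvgrNyPlt/(_ t) := esmooth_at0 phi_esmooth.
move=> f1_lt; near (0 : R)^'+ => u.
have u0 : 0 < u by near: u; exact: nbhs_right_gt.
have : f^`()%classic u < t by near: u.
rewrite -(leW_mono psi1_mono) derive1_conj_funK //; exact: lt_trans.
Unshelve. all: by end_near. Qed.

Lemma derive1_phiK t : f^`()%classic ((conj_fun phi)^`()%classic t) = t.
Proof.
have g0 := derive1_conj_fun_gt0 t.
by apply: (inc_inj psi1_mono); rewrite derive1_conj_funK.
Qed.

(** As phi >= 0 = phi 1, the point 1 is an interior minimum. *)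
Lemma derive1_phi1 : f^`()%classic 1 = 0.
Proof.
have f_ge0 u : 0 < u -> 0 <= f u.
  move=> u0; rewrite -lee_fin -phi_fineK //.
  by apply: (transf_ge0 phi_transf); rewrite /Rplus /= in_itv /= ltW.
have : is_derive (1 : R) 1 f 0.
  apply: (@derive1_at_min R f 0 2) => //.
  - by move=> t; rewrite in_itv /= => /andP[t0 _]; exact: (esmooth_derivable phi_esmooth).
  - by rewrite in_itv /=; apply/andP; split; lra.
  - move=> t; rewrite in_itv /= => /andP[t0 _].
    by rewrite /= (transf_at1 phi_transf) f_ge0.
by move=> [_]; rewrite derive1E.
Qed.

Lemma derive1_conj_fun0 : (conj_fun phi)^`()%classic 0 = 1.
Proof. by rewrite -derive1_phi1 derive1_conj_funK. Qed.

End LegendreDuality.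

(** * First and second derivatives of the inverse [k] of an increasing [g] with range ]0, +oo[ *)

Section InverseOfDerivative.
Variables (R : realType) (g k : R -> R).
Hypothesis g_derivable : forall t, derivable g t 1.
Hypothesis g1_derivable : forall t, derivable g^`()%classic t 1.
Hypothesis g2_continuous : continuous g^`(2)%classic.
Hypothesis g1_gt0 : forall t, 0 < g^`()%classic t.
Hypothesis gK : cancel g k.
Hypothesis kK : forall u, 0 < u -> g (k u) = u.

Lemma is_derive_inverse_gt0 (u : R) : 0 < u ->
  is_derive u 1 k (g^`()%classic (k u))^-1.
Proof.
move=> u0; rewrite -{1}(kK u0); apply: is_derive_inverse.
- by apply: filterE => t; exact: gK.
- by apply: filterE => t; exact/differentiable_continuous/derivable1_diffP.
- by rewrite derive1E; exact: derivableP.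
- by rewrite gt_eqF.
Qed.

Lemma is_derive_derive1_inverse (u : R) : 0 < u ->
  is_derive u 1 k^`()%classic
    (- g^`(2)%classic (k u) / g^`()%classic (k u) ^+ 3).
Proof.
move=> u0.
(* The formula k' = 1 / g'(k) is known only for positive arguments; these contain a neighbourhood of
   [u], which is enough to differentiate it. *)
apply: (@near_eq_is_derive _ _ _ (fun v => (g^`()%classic (k v))^-1)).
  near=> v.
  have v0 : 0 < v by near: v; exact: lt_nbhsr.
  by have [_ <-] := is_derive_inverse_gt0 v0; rewrite derive1E.
have dgk : is_derive u 1 (g^`()%classic \o k)
    (g^`(2)%classic (k u) * (g^`()%classic (k u))^-1).
  apply: is_derive1_comp; last exact: is_derive_inverse_gt0.
  by rewrite /derive1n /= derive1E; exact: derivableP.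
have n0 : g^`()%classic (k u) != 0 by rewrite gt_eqF.
have d := @is_deriveV _ (g^`()%classic \o k) u _ _ n0 dgk; apply: (is_derive_eq d).
by rewrite /GRing.scale /=; field.
Unshelve. all: by end_near. Qed.

Lemma derive1n2_inverse (u : R) : 0 < u ->
  k^`(2)%classic u = - g^`(2)%classic (k u) / g^`()%classic (k u) ^+ 3.
Proof.
by move=> /is_derive_derive1_inverse[_ <-]; rewrite /derive1n /= derive1E.
Qed.

(** Continuity of psi''' enters here, through the formula for k''; at u = 1 it feeds the limiting
    argument that yields the sign of k''. *)
Lemma derive1n2_inverse_continuous (u : R) : 0 < u ->
  {for u, continuous k^`(2)%classic}.
Proof.
move=> u0.
have ck : {for u, continuous k}.
  apply/differentiable_continuous/derivable1_diffP.
  by have [] := is_derive_inverse_gt0 u0.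
have cg1 t : {for t, continuous g^`()%classic}.
  exact/differentiable_continuous/derivable1_diffP.
have near_k2 : \forall v \near u,
    - g^`(2)%classic (k v) / g^`()%classic (k v) ^+ 3 = k^`(2)%classic v.
  near=> v; rewrite derive1n2_inverse //.
  by near: v; exact: lt_nbhsr.
change (k^`(2)%classic @ u --> k^`(2)%classic u).
rewrite derive1n2_inverse //; apply: cvg_trans (near_eq_cvg near_k2) _.
apply: cvgM.
  have c2 : (g^`(2)%classic \o k) v @[v --> u] --> g^`(2)%classic (k u).
    by apply: (continuous_comp ck); exact: g2_continuous.
  exact: cvgN c2.
apply: cvgV; first by rewrite expf_neq0 // gt_eqF.
have c1 : (g^`()%classic \o k) v @[v --> u] --> g^`()%classic (k u).
  by apply: (continuous_comp ck); exact: cg1.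
by rewrite !exprS expr0 mulr1; exact: (cvgM c1 (cvgM c1 c1)).
Unshelve. all: by end_near. Qed.

End InverseOfDerivative.

(** * The response function and its explicit inverse *)

Definition response_inverse (R : realType) (k : R -> R) (gamma p : R) : R :=
  k (p / gamma) - k ((1 - p) / (1 - gamma)).

Section Response.
Variables (R : realType) (psi k : R -> R).
Local Notation g := (psi^`()%classic).
Hypothesis g_continuous : continuous g.
Hypothesis g_mono : {mono g : x y / x <= y}.
Hypothesis g0 : g 0 = 1.
Hypothesis g_gt0 : forall t, 0 < g t.
Hypothesis gK : cancel g k.
Hypothesis kK : forall u, 0 < u -> g (k u) = u.
Variable gamma : R.
Hypothesis gamma01 : 0 < gamma < 1.

Local Notation W := (response_inverse k gamma).

Let gamma_gt0 : 0 < gamma. Proof. by case/andP: gamma01. Qed.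
Let gamma_lt1 : gamma < 1. Proof. by case/andP: gamma01. Qed.
Let gammaC_gt0 : 0 < 1 - gamma. Proof. by rewrite subr_gt0. Qed.

(** Both terms strictly decrease in [l], so the solution that [get] picks is the given one. *)
Lemma ell_unique (w l : R) :
  gamma * g (w - l) + (1 - gamma) * g (- l) = 1 -> ell psi gamma w = l.
Proof.
move=> hl; apply: get_unique => // l' /= hl'.
have glt x y : x < y -> g x < g y by rewrite (leW_mono g_mono).
have [ll'|l'l|//] := ltgtP l l'; exfalso.
  have : gamma * g (w - l') < gamma * g (w - l).
    by rewrite ltr_pM2l // glt //; lra.
  have : (1 - gamma) * g (- l') < (1 - gamma) * g (- l).
    by rewrite ltr_pM2l // glt //; lra.
  by lra.
have : gamma * g (w - l) < gamma * g (w - l').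
  by rewrite ltr_pM2l // glt //; lra.
have : (1 - gamma) * g (- l) < (1 - gamma) * g (- l').
  by rewrite ltr_pM2l // glt //; lra.
by lra.
Qed.

(** Intermediate values on [0, w]: as [g] increases and g 0 = 1, the left side is at least 1 at l =
    0 and at most 1 at l = w. *)
Lemma ell_exists (w : R) : 0 < w ->
  exists l, gamma * g (w - l) + (1 - gamma) * g (- l) = 1.
Proof.
move=> w0; pose h l := gamma * g (w - l) + (1 - gamma) * g (- l).
have ch : continuous h.
  move=> l; apply: cvgD; apply: cvgM; try exact: cvg_cst.
    apply: (@continuous_comp _ _ _ (fun x => w - x) g); last exact: g_continuous.
    by apply: cvgB; [exact: cvg_cst|exact: cvg_id].
  apply: (@continuous_comp _ _ _ -%R g); last exact: g_continuous.
  by apply: cvgN; exact: cvg_id.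
have [|l _ hl] := @IVT R h 0 w 1 (ltW w0) (continuous_subspaceT ch); last by exists l.
rewrite ge_min le_max; apply/andP; split; apply/orP; [right|left].
  have : (1 - gamma) * g (- w) <= (1 - gamma) * g 0.
    by rewrite ler_pM2l // g_mono; lra.
  by rewrite /h subrr g0; lra.
have : gamma * g 0 <= gamma * g w by rewrite ler_pM2l // g_mono ltW.
by rewrite /h subr0 oppr0 g0; lra.
Qed.

Lemma response_inverse_mono : {in `]gamma, 1[ &, {mono W : p q / p <= q}}.
Proof.
apply: le_mono_in => p q; rewrite !in_itv /= => /andP[gp p1] /andP[gq q1] pq.
have k_lt u v : 0 < u -> 0 < v -> u < v -> k u < k v.
  by move=> u0 v0 uv; rewrite -(leW_mono g_mono) !kK.
have p0 := lt_trans gamma_gt0 gp; have q0 := lt_trans gamma_gt0 gq.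
apply: ltrD; last rewrite ltrN2; apply: k_lt; rewrite ?divr_gt0 ?subr_gt0 ?gamma_lt1 //.
- by rewrite ltr_pM2r ?invr_gt0.
- by rewrite ltr_pM2r ?invr_gt0 //; lra.
Qed.

(** With l = - k ((1 - p) / (1 - gamma)) one has W p - l = k (p / gamma), so the equation for [l]
    reads p + (1 - p) = 1 and the response is [p]. *)
Lemma response_inverseK :
  {in `]gamma, 1[, cancel W (response psi gamma)}.
Proof.
move=> p; rewrite in_itv /= => /andP[gp p1].
have p0 : 0 < p by exact: lt_trans gp.
have pC0 : 0 < 1 - p by rewrite subr_gt0.
rewrite /response (@ell_unique _ (- k ((1 - p) / (1 - gamma)))).
  rewrite /response_inverse opprK subrK kK ?divr_gt0 // mulrC divfK //.
  by rewrite gt_eqF.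
rewrite /response_inverse !opprK subrK !kK ?divr_gt0 //.
by field; rewrite !gt_eqF.
Qed.

(** Here (1 - p) / (1 - gamma) < 1 < p / gamma, and [k] is increasing. *)
Lemma response_inverse_gt0 p : gamma < p < 1 -> 0 < W p.
Proof.
move=> /andP[gp p1]; have p0 := lt_trans gamma_gt0 gp; rewrite subr_gt0.
rewrite -(leW_mono g_mono) !kK ?divr_gt0 ?subr_gt0 ?gamma_lt1 //.
apply: (@lt_trans _ _ 1); first by rewrite ltr_pdivrMr //; lra.
by rewrite ltr_pdivlMr //; lra.
Qed.

Lemma response_itv w : 0 < w -> gamma < response psi gamma w < 1.
Proof.
move=> w0; have [l hl] := ell_exists w0.
rewrite /response (ell_unique hl).
apply/andP; split; last first.
  have : 0 < (1 - gamma) * g (- l) by rewrite mulr_gt0.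
  by lra.
rewrite -[ltLHS]mulr1 ltr_pM2l // -g0 (leW_mono g_mono) ltNge.
(* If w - l <= 0, then also - l < 0, so the two weighted values of [g] sum to less than 1. *)
apply/negP => wl.
have : gamma * g (w - l) <= gamma * g 0 by rewrite ler_pM2l // g_mono.
have : (1 - gamma) * g (- l) < (1 - gamma) * g 0.
  by rewrite ltr_pM2l // (leW_mono g_mono); lra.
by rewrite g0; lra.
Qed.

(** For p = gamma g (w - l) the equation gives 1 - p = (1 - gamma) g (- l), so W p = (w - l) - (- l)
    = w. *)
Lemma responseK : {in `]0, +oo[, cancel (response psi gamma) W}.
Proof.
move=> w; rewrite in_itv /= andbT => w0; have [l hl] := ell_exists w0.
rewrite /response (ell_unique hl) /response_inverse.
rewrite [gamma * _]mulrC mulfK ?gt_eqF // gK mulrC.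
have -> : 1 - gamma * g (w - l) = (1 - gamma) * g (- l) by lra.
by rewrite mulrAC divff ?gt_eqF // mul1r gK; ring.
Qed.

End Response.

(** * Convexity of the inverse response in terms of k'' *)

Lemma is_derive_mixture (R : realType) (h : R -> R) (gamma a b p d e : R) :
  is_derive (p / gamma) 1 h d -> is_derive ((1 - p) / (1 - gamma)) 1 h e ->
  is_derive p 1 (fun q => a * h (q / gamma) + b * h ((1 - q) / (1 - gamma)))
    (a * (d / gamma) - b * (e / (1 - gamma))).
Proof.
move=> hd he.
have affine (u v : R) : is_derive p 1 (fun q : R => u * q + v) u.
  have -> : (fun q : R => u * q + v) = (u \*: (id : R -> R)) + cst v by [].
  by apply: is_derive_eq; rewrite addr0 /GRing.scale /= mulr1.
have dl : is_derive p 1 (fun q : R => q / gamma) gamma^-1.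
  have -> : (fun q : R => q / gamma) = (fun q => gamma^-1 * q + 0).
    by apply/funext => q; rewrite addr0 mulrC.
  exact: affine.
have dr : is_derive p 1 (fun q : R => (1 - q) / (1 - gamma)) (- (1 - gamma)^-1).
  have -> : (fun q : R => (1 - q) / (1 - gamma)) =
      (fun q => - (1 - gamma)^-1 * q + (1 - gamma)^-1).
    by apply/funext => q; ring.
  exact: affine.
have dhl := @is_derive1_comp _ h (fun q : R => q / gamma) p _ _ hd dl.
have dhr := @is_derive1_comp _ h (fun q : R => (1 - q) / (1 - gamma)) p _ _ he dr.
have H := is_deriveD (is_deriveZ a dhl) (is_deriveZ b dhr).
by apply: (is_derive_eq H); rewrite /GRing.scale /=; ring.
Qed.

Section Convexity.
Variables (R : realType) (k : R -> R).
Hypothesis k_derivable : forall u, 0 < u -> derivable k u 1.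
Hypothesis k1_derivable : forall u, 0 < u -> derivable k^`()%classic u 1.

(** The inequality says W'' >= 0: the inner derivative of 1 - p turns the minus sign of [W] into a
    plus in W' and back into a minus in W''. *)
Lemma response_inverse_convexP (gamma : R) : 0 < gamma < 1 ->
  convex_function `]gamma, 1[%classic (response_inverse k gamma : R -> R^o) <->
  {in `]gamma, 1[, forall p,
    k^`(2)%classic ((1 - p) / (1 - gamma)) / (1 - gamma) ^+ 2 <=
    k^`(2)%classic (p / gamma) / gamma ^+ 2}.
Proof.
move=> /andP[gamma0 gamma1]; set W := response_inverse k gamma.
have args p : p \in `]gamma, 1[ -> 0 < p / gamma /\ 0 < (1 - p) / (1 - gamma).
  rewrite in_itv /= => /andP[gp p1].
  by rewrite !divr_gt0 ?subr_gt0 // (lt_trans gamma0).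
have dW p : p \in `]gamma, 1[ -> is_derive p 1 W
    (k^`()%classic (p / gamma) / gamma +
     k^`()%classic ((1 - p) / (1 - gamma)) / (1 - gamma)).
  move=> /args[/k_derivable/derivableP + /k_derivable/derivableP].
  rewrite -!derive1E => d e.
  have -> : W = fun q => 1 * k (q / gamma) + (-1) * k ((1 - q) / (1 - gamma)).
    by apply/funext => q; rewrite mul1r mulN1r.
  by apply: (is_derive_eq (is_derive_mixture _ _ d e)); ring.
have ddW p : p \in `]gamma, 1[ -> is_derive p 1 W^`()%classic
    (k^`(2)%classic (p / gamma) / gamma ^+ 2 -
     k^`(2)%classic ((1 - p) / (1 - gamma)) / (1 - gamma) ^+ 2).
  move=> pI; have [/k1_derivable/derivableP + /k1_derivable/derivableP] := args p pI.
  rewrite -!derive1E => d e.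
  (* The formula for W' holds near [p]; it is again a mixture, now of k' with coefficients 1 / gamma
     and 1 / (1 - gamma). *)
  refine (@near_eq_is_derive _ R R (fun q : R => gamma^-1 * k^`()%classic (q / gamma) +
      (1 - gamma)^-1 * k^`()%classic ((1 - q) / (1 - gamma))) _ p 1 _ _ _).
    near=> q.
    have /dW[_] : q \in `]gamma, 1[ by near: q; exact: near_in_itvoo.
    by rewrite -derive1E => ->; rewrite ![_^-1 * _]mulrC.
  apply: (is_derive_eq (is_derive_mixture _ _ d e)).
  by rewrite /derive1n /= !expr2 !invfM; congr (_ - _); rewrite mulrCA.
rewrite convex_second_derivativeP; last 2 first.
- by move=> p /dW[].
- by move=> p /ddW[].
split=> H p pI; have := H p pI; have [_] := ddW p pI.
  by rewrite -derive1E {1}/derive1n /= => ->; rewrite subr_ge0.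
by rewrite -derive1E {2}/derive1n /= => ->; rewrite subr_ge0.
Unshelve. all: by end_near. Qed.

End Convexity.

(** * From the inequalities for all [gamma] to the sign of k'' on each side of 1 *)

Lemma sign_of_ratio_ineq (R : realType) (k2 : R -> R) :
  {for 1, continuous k2} ->
  (forall gamma, 0 < gamma < 1 -> {in `]gamma, 1[, forall p,
    k2 ((1 - p) / (1 - gamma)) / (1 - gamma) ^+ 2 <=
    k2 (p / gamma) / gamma ^+ 2}) <->
  (forall t, 0 < t < 1 -> k2 t <= 0) /\ (forall t, 1 < t -> 0 <= k2 t).
Proof.
move=> ck2; split=> [ineq|[k2_le0 k2_ge0] gamma /andP[g0 g1] p]; last first.
  rewrite in_itv /= => /andP[gp p1].
  apply: (@le_trans _ _ 0).
    rewrite pmulr_lle0 ?invr_gt0 ?exprn_gt0 ?subr_gt0 //.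
    apply: k2_le0; rewrite divr_gt0 ?subr_gt0 //=.
    by rewrite ltr_pdivrMr ?subr_gt0 //; lra.
  rewrite divr_ge0 ?sqr_ge0 // k2_ge0 //.
  by rewrite ltr_pdivlMr // mul1r.
(* With this [h] the inequality for a pair b < 1 < a takes the separated form h b <= h a. *)
pose h (t : R) := k2 t * (t - 1) ^+ 2.
have h_le a b : 1 < a -> 0 < b < 1 -> h b <= h a.
  move=> a1 /andP[b0 b1].
  have ab : 0 < a - b by lra.
  have [a1' b1'] : 0 < a - 1 /\ 0 < 1 - b by split; lra.
  (* This [gamma] solves gamma a + (1 - gamma) b = 1, so p = gamma a gives p / gamma = a and (1 - p)
     / (1 - gamma) = b. *)
  pose gamma := (1 - b) / (a - b).
  have gE : 1 - gamma = (a - 1) / (a - b) by rewrite /gamma; field; rewrite gt_eqF.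
  have gamma0 : 0 < gamma by rewrite divr_gt0.
  have gammaC0 : 0 < 1 - gamma by rewrite gE divr_gt0.
  have pE : 1 - gamma * a = (1 - gamma) * b.
    by rewrite /gamma; field; rewrite gt_eqF.
  have := ineq gamma _ (gamma * a).
  rewrite gamma0 -subr_gt0 gammaC0 => /(_ isT).
  rewrite in_itv /= ltr_pMr // a1 -[_ < 1]subr_gt0 pE mulr_gt0 // => /(_ isT).
  rewrite [gamma * a]mulrC [(1 - gamma) * b]mulrC !mulfK ?gt_eqF //.
  rewrite ler_pdivrMr ?exprn_gt0 // mulrAC ler_pdivlMr ?exprn_gt0 //.
  rewrite gE /gamma !expr_div_n !mulrA ler_pM2r ?invr_gt0 ?exprn_gt0 //.
  by rewrite /h => H; lra.
have h1 : h x @[x --> (1 : R)] --> (0 : R).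
  have -> : 0 = k2 1 * (1 - 1) ^+ 2 by rewrite subrr expr0n mulr0.
  apply: cvgM; first exact: ck2.
  have c1 : x - 1 @[x --> (1 : R)] --> (1 - 1 : R).
    by apply: cvgB; [exact: cvg_id|exact: cvg_cst].
  exact: (cvgM c1 c1).
have sqr_gt0 t : t != 1 -> 0 < (t - 1) ^+ 2 :> R.
  by move=> t1; rewrite lt_neqAle sqr_ge0 eq_sym sqrf_eq0 subr_eq0 t1.
split=> [b b01|a a1].
  have b1 : b != 1 by case/andP: b01 => _ /lt_eqF ->.
  rewrite -(pmulr_lle0 _ (sqr_gt0 b b1)) -/(h b).
  (* With [b] fixed, h b <= h a for every a > 1, and h a tends to 0 as [a] decreases to 1. *)
  have c := cvg_at_right_filter h1.
  rewrite -(cvg_lim _ c) //; apply: limr_ge; first by apply/cvg_ex; exists 0.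
  by near=> a; apply: h_le => //; near: a; exact: nbhs_right_gt.
have a1' : a != 1 by rewrite gt_eqF.
rewrite -(pmulr_lge0 _ (sqr_gt0 a a1')) -/(h a).
have c := cvg_at_left_filter h1.
rewrite -(cvg_lim _ c) //; apply: limr_le; first by apply/cvg_ex; exists 0.
near=> b; apply: h_le => //; apply/andP; split.
- by near: b; exact: nbhs_left_gt.
- by near: b; exact: nbhs_left_lt.
Unshelve. all: by end_near. Qed.

Lemma convex_set_itv (R : realType) (i : interval R) :
  convex_set ([set` i] : set (convex_lmodType R^o)).
Proof.
move=> x y t /set_mem /= xi /set_mem /= yi; apply: mem_set => /=.
wlog xy : x y t xi yi / x <= y.
  move=> H; have [/H|/ltW/H] := leP x y; first exact.
  by rewrite convC; apply.
have := convR_itv t xy; rewrite in_itv /= => /andP[xz zy].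
by apply: (@interval_is_interval _ i x y) => //; rewrite xz.
Qed.

(** * The three statements, each compared with the sign of k'' *)

Theorem proposition10 (R : realType) (phi : R -> \bar R)
    (phi_transf : transformation phi)
    (phi_esmooth : essentially_smooth phi)
    (psi_C3 : thrice_continuously_differentiable (conj_fun phi))
    (psi2_gt0 : forall t : R, 0 < (conj_fun phi)^`(2)%classic t) :
  [<-> (forall gamma : R, 0 < gamma < 1 ->
          concave_function `]0, +oo[ (response (conj_fun phi) gamma));
       ((forall t : R, t < 0 -> 0 <= R_ratio (conj_fun phi)^`()%classic t) /\
        (forall t : R, 0 < t -> R_ratio (conj_fun phi)^`()%classic t <= 0));
       ((forall t : R, 0 < t < 1 -> (fine \o phi)^`(3)%classic t <= 0) /\
        (forall t : R, 1 < t -> 0 <= (fine \o phi)^`(3)%classic t))].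
Proof.
have [psi_derivable psi3_continuous] := psi_C3.
set psi := conj_fun phi in psi_derivable psi3_continuous psi2_gt0 *.
pose g := psi^`()%classic; pose k := (fine \o phi)^`()%classic.
have dpsi : forall t, derivable psi t 1 := psi_derivable 0%N isT.
have dg : forall t, derivable g t 1 := psi_derivable 1%N isT.
have dg1 : forall t, derivable g^`()%classic t 1 := psi_derivable 2%N isT.
have g1_gt0 : forall t, 0 < g^`()%classic t := psi2_gt0.
have g2_continuous : continuous g^`(2)%classic := psi3_continuous.
have g_mono : {mono g : x y / x <= y} := increasing_of_derive1_gt0 dg g1_gt0.
have g_lt : {mono g : x y / x < y} := leW_mono g_mono.
have kK u : 0 < u -> g (k u) = u.
  exact: (derive1_conj_funK phi_transf phi_esmooth dpsi).
have g_gt0 t : 0 < g t.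
  exact: (derive1_conj_fun_gt0 phi_transf phi_esmooth dpsi g_mono).
have gK : cancel g k.
  exact: (derive1_phiK phi_transf phi_esmooth dpsi g_mono).
have g0 : g 0 = 1 by exact: (derive1_conj_fun0 phi_transf phi_esmooth dpsi).
have gc : continuous g.
  by move=> t; exact/differentiable_continuous/derivable1_diffP.
have dk u : 0 < u -> derivable k u 1.
  by move=> /(is_derive_inverse_gt0 dg g1_gt0 gK kK)[].
have dk1 u : 0 < u -> derivable k^`()%classic u 1.
  by move=> /(is_derive_derive1_inverse dg dg1 g1_gt0 gK kK)[].
have k2_continuous : {for 1, continuous k^`(2)%classic}.
  exact: (derive1n2_inverse_continuous dg dg1 g2_continuous g1_gt0 gK kK ltr01).
(* Evaluated at [g t], k'' has the sign opposite to that of the ratio at [t]. *)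
have k2E t : k^`(2)%classic (g t) = - R_ratio g t / g^`()%classic t ^+ 2.
  rewrite (derive1n2_inverse dg dg1 g1_gt0 gK kK (g_gt0 t)) gK /R_ratio.
  by field; rewrite gt_eqF.
have ratioP : ((forall t, t < 0 -> 0 <= R_ratio g t) /\
               (forall t, 0 < t -> R_ratio g t <= 0)) <->
              ((forall t, 0 < t < 1 -> k^`(2)%classic t <= 0) /\
               (forall t, 1 < t -> 0 <= k^`(2)%classic t)).
  (* Since [g] increases with g 0 = 1 and g > 0, negative [t] correspond to values in ]0, 1[ and
     positive [t] to values above 1. *)
  have sq t : 0 < (g^`()%classic t ^+ 2)^-1 by rewrite invr_gt0 exprn_gt0.
  split=> -[H1 H2]; split=> t.
  - move=> /andP[t0 t1]; rewrite -(kK t t0) k2E pmulr_lle0 // oppr_le0.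
    by apply: H1; rewrite -g_lt kK // g0.
  - move=> t1; have t0 := lt_trans ltr01 t1.
    rewrite -(kK t t0) k2E pmulr_lge0 // oppr_ge0.
    by apply: H2; rewrite -g_lt kK // g0.
  - move=> t0; rewrite -oppr_le0 -(pmulr_lle0 _ (sq t)) -k2E.
    by apply: H1; rewrite g_gt0 -g0 g_lt.
  - move=> t0; rewrite -oppr_ge0 -(pmulr_lge0 _ (sq t)) -k2E.
    by apply: H2; rewrite -g0 g_lt.
have concaveP : (forall gamma, 0 < gamma < 1 ->
                   concave_function `]0, +oo[ (response psi gamma)) <->
              ((forall t, 0 < t < 1 -> k^`(2)%classic t <= 0) /\
               (forall t, 1 < t -> 0 <= k^`(2)%classic t)).
  rewrite -(sign_of_ratio_ineq k2_continuous).
  (* For each fixed [gamma], the response is the inverse of an increasing bijection from ]gamma,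
     1[ onto ]0, +oo[. *)
  have step gamma : 0 < gamma < 1 ->
      concave_function `]0, +oo[ (response psi gamma) <->
      {in `]gamma, 1[, forall p,
        k^`(2)%classic ((1 - p) / (1 - gamma)) / (1 - gamma) ^+ 2 <=
        k^`(2)%classic (p / gamma) / gamma ^+ 2}.
    move=> gamma01; rewrite -(response_inverse_convexP dk dk1 gamma01).
    apply: concave_inverse; [exact: convex_set_itv|exact: convex_set_itv|..].
    - move=> p q /set_mem pI /set_mem qI.
      exact: (response_inverse_mono g_mono kK gamma01 pI qI).
    - move=> p; rewrite /= !in_itv /= andbT.
      exact: (response_inverse_gt0 g_mono kK gamma01).
    - move=> w; rewrite /= !in_itv /= andbT.
      exact: (response_itv gc g_mono g0 g_gt0 gamma01).
    - move=> p /set_mem; exact: (response_inverseK g_mono kK gamma01).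
    - move=> w /set_mem; exact: (responseK gc g_mono g0 gK gamma01).
  by split=> H gamma gamma01; apply/step => //; exact: H.
(* As [k] is phi', the sign condition on k'' is statement (iii) by unfolding. *)
tfae.
- by move=> /concaveP/ratioP.
- by move=> /ratioP.
- by move=> /concaveP.
Qed.
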